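(* Let $N$ be a finite set with $|N|\geq 2$. A linear inequality $\langle \alpha, m\rangle \geq 0$ (with $\alpha\in\mathbb{R}^{\mathcal{P}(N)}$) is facet-defining for the cone $T(N)$ if and only if $\alpha$ is a positive multiple of $\alpha_{\mathcal{B}}$ for some non-trivial irreducible min-balanced system $\mathcal{B}$ with $\bigcup\mathcal{B}\subseteq N$. In other words, the facet-defining inequalities for $T(N)$ are exactly the inequalities $\langle\alpha_{\mathcal{B}},m\rangle\geq 0$ corresponding to non-trivial irreducible min-balanced systems $\mathcal{B}$ with $\bigcup\mathcal{B}\subseteq N$.
   Context: $N$ is a finite set of players. $\mathcal{P}(N)$ is the set of all subsets of $N$; $\mathbb{R}^{\mathcal{P}(N)}$ is the space of real set functions $m:\mathcal{P}(N)\to\mathbb{R}$ with scalar product $\langle\theta,m\rangle=\sum_{S\subseteq N}\theta(S)m(S)$. For $A\subseteq N$, $\chi_A\in\mathbb{R}^N$ is the incidence vector of $A$. A game is $m\in\mathbb{R}^{\mathcal{P}(N)}$ with $m(\emptyset)=0$. The core of a game $m$ is $C(m)=\{x\in\mathbb{R}^N:\sum_{i\in N}x_i=m(N),\ \sum_{i\in S}x_i\geq m(S)\ \forall S\subseteq N\}$; $m$ is balanced if $C(m)\neq\emptyset$, and totally balanced if for every nonempty $A\subseteq N$ the restriction of $m$ to $\mathcal{P}(A)$ (a game over player set $A$) is balanced. For $m\in\mathbb{R}^{\mathcal{P}(N)}$ put $\tilde m(S)=m(S)-m(\emptyset)$; $T(N)=\{m\in\mathbb{R}^{\mathcal{P}(N)}:\tilde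 m \text{ is totally balanced}\}$, a polyhedral cone. A set system is a subset $\mathcal{B}\subseteq\mathcal{P}(N)$; its carrier is $\bigcup\mathcal{B}$. A non-empty $\mathcal{B}$ is min-balanced if $\chi_{\bigcup\mathcal{B}}$ lies in the conic hull of $\{\chi_S:S\in\mathcal{B}\}$ and no proper subsystem $\mathcal{B}'\subsetneq\mathcal{B}$ has the property that $\chi_{\bigcup\mathcal{B}'}$ lies in the conic hull of $\{\chi_S:S\in\mathcal{B}'\}$; it is then said to be min-balanced on $M=\bigcup\mathcal{B}$, and non-trivial if $|\mathcal{B}|\geq2$. For a non-trivial min-balanced $\mathcal{B}$ with carrier $M$ there are unique coefficients $\lambda_S>0$ ($S\in\mathcal{B}$) with $\chi_M=\sum_{S\in\mathcal{B}}\lambda_S\chi_S$, and they are rational; let $k$ be the smallest positive integer such that all $k\lambda_S$ are integers. Define $\alpha_{\mathcal{B}}\in\mathbb{Z}^{\mathcal{P}(N)}$ by $\alpha_{\mathcal{B}}(M)=k$, $\alpha_{\mathcal{B}}(S)=-k\lambda_S$ for $S\in\mathcal{B}$, $\alpha_{\mathcal{B}}(\emptyset)=-k+k\sum_{S\in\mathcal{B}}\lambda_S$, and $\alpha_{\mathcal{B}}(S)=0$ otherwise; the inequality corresponding to $\mathcal{B}$ is $\langle\alpha_{\mathcal{B}},m\rangle\geq0$. A min-balanced $\mathcal{B}$ is reducible if there exist $A\subsetneq\bigcup\mathcal{B}$ and $B\in\mathcal{B}_A:=\{S\in\mathcal{B}:S\subsetneq A\}$ such that (1) $\chi_A$ is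 in the conic hull of $\{\chi_S:S\in\mathcal{B}_A\}$ and (2) $\chi_{\bigcup\mathcal{B}}$ is in the conic hull of $\{\chi_T:T\in\{A\}\cup(\mathcal{B}\setminus\{B\})\}$; otherwise it is irreducible. An inequality $\langle\alpha,m\rangle\ge0$ is facet-defining for a cone $K$ if it holds on $K$ and $\{m\in K:\langle\alpha,m\rangle=0\}$ is a facet of $K$.
   Formalization: Minimality of a min-balanced system is taken with the carrier of the whole system kept fixed (no proper subsystem has the incidence vector of ⋃B in its conic hull); with the subsystem's own carrier, no non-trivial min-balanced system would exist. *)

(* Defs.v *)
From HB Require Import structures.
From mathcomp Require Import all_boot all_order all_algebra.
From mathcomp Require Import boolp classical_sets reals.

Set Implicit Arguments.
Unset Strict Implicit.
Unset Printing Implicit Defensive.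

Import Order.TTheory GRing.Theory Num.Theory.
Local Open Scope ring_scope.

(* The player set is the finite type N.  The codomain R^o rather than R makes
   {ffun N -> R^o} and {ffun {set N} -> R^o} canonical R-vector spaces. *)

Section Games.
Variables (R : realType) (N : finType).
Implicit Types (m : {ffun {set N} -> R^o}) (A : {set N}).

Definition core m : set {ffun N -> R^o} :=
  [set x | \sum_(i : N) x i = m [set: N]%SET /\
           forall S : {set N}, m S <= \sum_(i in S) x i]%classic.

Definition balanced m : Prop := exists x, core m x.

Definition tilde m : {ffun {set N} -> R^o} := [ffun S => m S - m finset.set0].

(* The restriction of m to the subsets of A, as a game whose player set is the
   subtype of elements of A. *)
Definition restrict A m : {ffun {set {i : N | i \in A}} -> R^o} :=
  [ffun S : {set {i : N | i \in A}} => m (val @: S)].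

End Games.

Definition totally_balanced (R : realType) (N : finType)
    (m : {ffun {set N} -> R^o}) : Prop :=
  forall A : {set N}, A != finset.set0 -> balanced (restrict A m).

Definition tb_cone (R : realType) (N : finType) : set {ffun {set N} -> R^o} :=
  [set m | totally_balanced (tilde m)]%classic.

Section SetSystems.
Variables (R : realType) (N : finType).
Implicit Types (A : {set N}) (B : {set {set N}}).

Definition chi A : {ffun N -> R^o} := [ffun i => (i \in A)%:R].

(* The conic hull of {chi_S : S in B}; it is {0} when B is empty. *)
Definition chi_cone B : set {ffun N -> R^o} :=
  [set x | exists2 c : {set N} -> R,
     (forall S, S \in B -> 0 <= c S) &
     x = \sum_(S in B) c S *: chi S]%classic.

(* In the minimality clause the target vector stays the incidence vector of the
   carrier of B: every {S} satisfies chi_S \in cone {chi_S}, so a target moving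
   with the subsystem would leave no system with two or more members. *)
Definition min_balanced B : Prop :=
  [/\ B != finset.set0,
      chi_cone B (chi (finset.cover B)) &
      forall B' : {set {set N}},
        B' \proper B -> ~ chi_cone B' (chi (finset.cover B))].

Definition nontrivial B : Prop := (2 <= #|B|)%N.

Definition strict_below B A : {set {set N}} := [set S in B | S \proper A]%SET.

Definition reducible B : Prop :=
  exists A S : {set N},
    [/\ A \proper finset.cover B,
        S \in strict_below B A,
        chi_cone (strict_below B A) (chi A) &
        chi_cone (A |: (B :\ S))%SET (chi (finset.cover B))].

Definition balancing_coefs B (c : {ffun {set N} -> R^o}) : Prop :=
  [/\ forall S, S \in B -> 0 < c S,
      forall S, S \notin B -> c S = 0 &
      chi (finset.cover B) = \sum_(S in B) c S *: chi S].

Definition lambda B : {ffun {set N} -> R^o} := xget 0 (balancing_coefs B).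

Definition clears_denominators B (k : nat) : Prop :=
  (0 < k)%N /\ forall S, S \in B -> k%:R * (lambda B S : R) \is a Num.int.

Definition least_multiplier B : nat :=
  xget 0%N [set k | clears_denominators B k /\
                    forall j, clears_denominators B j -> (k <= j)%N]%classic.

(* For a non-trivial min-balanced B the carrier, the members of B and the empty
   set are pairwise distinct, so the order of the tests is immaterial. *)
Definition alpha_of B : {ffun {set N} -> R^o} :=
  let k : R := (least_multiplier B)%:R in
  [ffun S : {set N} =>
     if S == finset.cover B then k
     else if S \in B then - (k * lambda B S)
     else if S == finset.set0 then - k + k * \sum_(T in B) lambda B T
     else 0].

End SetSystems.

Section Facets.
Variable R : realType.

(* X is non-empty and d is the dimension of its affine hull, i.e. of the least
   linear subspace containing all differences of elements of X. *)
Definition has_affine_dim (V : vectType R) (X : set V) (d : nat) : Prop :=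
  (exists x, X x) /\
  exists U : {vspace V},
    [/\ forall x y, X x -> X y -> x - y \in U,
        forall W : {vspace V},
          (forall x y, X x -> X y -> x - y \in W) -> (U <= W)%VS &
        \dim U = d].

Variable N : finType.
Implicit Types (a m : {ffun {set N} -> R^o}) (K F : set {ffun {set N} -> R^o}).

Definition scalar_prod a m : R := \sum_(S : {set N}) a S * m S.

Definition valid_ineq K a : Prop := forall m, K m -> 0 <= scalar_prod a m.

Definition tight_set K a : set {ffun {set N} -> R^o} :=
  [set m | K m /\ scalar_prod a m = 0]%classic.

Definition is_face K F : Prop := exists2 a, valid_ineq K a & F = tight_set K a.

Definition is_facet K F : Prop :=
  is_face K F /\ exists d, has_affine_dim F d /\ has_affine_dim K d.+1.

Definition facet_defining K a : Prop :=
  valid_ineq K a /\ is_facet K (tight_set K a).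

End Facets.

(* Main.v *)
(** A vector x has mass x(S) = sum_(i in S) x_i.  Call m slack at A if some x
    with x(A) = m(A) satisfies x(S) > m(S) for all nonempty S properly included
    in A; a game that is slack everywhere is interior to the cone.

    If alpha defines a facet F, suppose that for every min-balanced B some point
    of F has alpha_B > 0.  The sum of these points is in F, hence not slack at
    some A; by Gordan's alternative chi_A is a conic combination of proper
    subsets for which the core inequality at A is tight, and one of minimal
    support is a min-balanced system, a contradiction.  So some alpha_B vanishes
    on F and is proportional to alpha.  A reducible B writes alpha_B as a sum of
    two valid functionals that are not proportional to it.

    Conversely, B is irreducible iff no nonempty A strictly inside its carrier
    has chi_A in the cone of the members of B strictly below A.  The separating
    vectors so obtained yield a game that is slack at every A except the carrier
    of B, where it stays feasible under every small perturbation orthogonal to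
    alpha_B because the vectors chi_S, S in B, are linearly independent. *)

Require Import Defs.
From HB Require Import structures.
From mathcomp Require Import all_boot all_order all_algebra.
From mathcomp Require Import boolp classical_sets reals.
From mathcomp Require Import ring lra.
(* Finite sets take precedence over classical sets for set0, subsetP, etc. *)
Import mathcomp.boot.fintype mathcomp.boot.finset.

Set Implicit Arguments.
Unset Strict Implicit.
Unset Printing Implicit Defensive.

Import Order.TTheory GRing.Theory Num.Theory.
Local Open Scope ring_scope.

(** * Theorems of the alternative *)

Section Alternatives.
Variable R : realFieldType.

(** Let [s1] minimize [l s / d s] over the indices with [d s] positive: moving from [l] along [- d],
    coordinate [s1] is the first to reach zero. This is the tool for shrinking supports. *)
Lemma ratio_test (T : finType) (l d : T -> R) (s0 : T) :
  (forall s, 0 <= l s) -> 0 < d s0 ->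
  exists2 s1, 0 < d s1 & forall s, 0 <= l s - l s1 / d s1 * d s.
Proof.
move=> l0 ds0.
case: (@Order.TotalTheory.arg_minP _ _ _ s0 (fun s => 0 < d s) (fun s => l s / d s) ds0).
move=> s1 ds1 s1_min; exists s1 => // s.
have t0 : 0 <= l s1 / d s1 by rewrite divr_ge0 ?l0 ?ltW.
have [ds|ds] := ltP 0 (d s).
  by rewrite subr_ge0 -ler_pdivlMr //; apply: s1_min.
by rewrite subr_ge0 (le_trans _ (l0 s)) // mulr_ge0_le0.
Qed.

Lemma small_forall (T : finType) (P : T -> R -> Prop) :
  (forall j, exists2 e0, 0 < e0 & forall e, 0 < e <= e0 -> P j e) ->
  exists2 e0, 0 < e0 & forall e, 0 < e <= e0 -> forall j, P j e.
Proof.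
move=> H; have /choice[f fP] : forall j, exists e0,
    0 < e0 /\ forall e, 0 < e <= e0 -> P j e.
  by move=> j; have [e ? ?] := H j; exists e.
have f0 j : 0 < f j by case: (fP j).
have s0 : 0 <= \sum_j (f j)^-1 by apply: sumr_ge0 => j _; rewrite invr_ge0 ltW.
have s1 : 0 < 1 + \sum_j (f j)^-1 by rewrite ltr_pwDl.
(* This lies below every [f j] and makes sense also for an empty [T]. *)
exists (1 + \sum_j (f j)^-1)^-1; first by rewrite invr_gt0.
move=> e /andP[e0 ele] j; case: (fP j) => _; apply; rewrite e0 (le_trans ele) //.
rewrite invf_ple ?posrE // (bigD1 j) //= addrCA lerDl addr_ge0 //.
by apply: sumr_ge0 => k _; rewrite invr_ge0 ltW.
Qed.

Lemma small_affine_gt0 (a b : R) : 0 < a ->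
  exists2 e0, 0 < e0 & forall e, 0 < e <= e0 -> 0 < a + e * b.
Proof.
move=> a0; have b1 : 0 < `|b| + 1 by rewrite ltr_wpDl.
exists (a / (`|b| + 1)); first by rewrite divr_gt0.
move=> e /andP[e0]; rewrite ler_pdivlMr // => H.
have : - (e * `|b|) <= e * b.
  by rewrite -mulrN ler_pM2l // lerNl ler_normr lexx orbT.
rewrite mulrDr mulr1 in H; lra.
Qed.

Definition dot (I : finType) (x y : I -> R) : R := \sum_i x i * y i.

Lemma dotC (I : finType) (x y : I -> R) : dot x y = dot y x.
Proof. by apply: eq_bigr => i _; rewrite mulrC. Qed.

Lemma dot_linear (I : finType) (a : R) (x y z : I -> R) :
  dot (fun i => x i + a * y i) z = dot x z + a * dot y z.
Proof.
by rewrite /dot mulr_sumr -big_split; apply: eq_bigr => i _; rewrite /= mulrDl mulrA.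
Qed.

Lemma dot_sum (I : finType) k (c : nat -> R) (v : nat -> I -> R) (z : I -> R) :
  dot (fun i => \sum_(j < k) c j * v j i) z = \sum_(j < k) c j * dot (v j) z.
Proof.
rewrite /dot; under eq_bigr do rewrite mulr_suml.
rewrite exchange_big; apply: eq_bigr => j _; rewrite mulr_sumr.
by apply: eq_bigr => i _; rewrite mulrA.
Qed.

Lemma dot_self_gt0 (I : finType) (w : I -> R) i : w i != 0 -> 0 < dot w w.
Proof.
move=> wi; rewrite /dot (bigD1 i) //= ltr_wpDr //; last by rewrite -expr2 exprn_even_gt0.
by apply: sumr_ge0 => j _; rewrite -expr2 sqr_ge0.
Qed.

(* Induction on the number of vectors: the last one, w, is projected away.
   A dependency of the projections reads sum c_j v_j = s w; for s > 0 the
   vector w lies in the cone of the others and may be forgotten. *)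
Lemma gordan_nat (I : finType) k (v : nat -> I -> R) :
  (exists y, forall j, (j < k)%N -> 0 < dot y (v j)) \/
  exists c : nat -> R, [/\ forall j, 0 <= c j,
    exists2 j, (j < k)%N & 0 < c j & forall i, \sum_(j < k) c j * v j i = 0].
Proof.
elim: k v => [|k IH] v; first by left; exists (fun=> 0).
pose w := v k; have [[i0 wi0]|w0] := pselect (exists i, w i != 0); last first.
  right; exists (fun j => (j == k)%:R); split=> [j||i]; first exact: ler0n.
    by exists k => //; rewrite eqxx ltr01.
  rewrite big_ord_recr /= eqxx mul1r big1 => [|j _]; last first.
    by rewrite ltn_eqF ?ltn_ord //= mul0r.
  by rewrite add0r; apply/eqP/negP => /negP wi; apply: w0; exists i.
have ww := dot_self_gt0 wi0; have wwN0 : dot w w != 0 by rewrite gt_eqF.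
(* Orthogonal projection along [w]. It is self-adjoint, so [p y] is positive on each [v j] and
   orthogonal to [w]; adding a small multiple of [w] repairs the latter. *)
pose p (x : I -> R) i := x i + (- (dot x w / dot w w)) * w i.
case: (IH (fun j => p (v j))) => [[y yP]|[c [c0 [j1 j1k cj1] cP]]].
- have pE x z : dot (p x) z = dot x z - dot x w / dot w w * dot w z.
    by rewrite dot_linear mulNr.
  have pw : dot (p y) w = 0 by rewrite pE; field.
  have pv j : dot (p y) (v j) = dot y (p (v j)).
    by rewrite [RHS]dotC !pE (dotC w (v j)) (dotC (v j) y) (dotC w y); field.
  have [|e0 e0_gt0 e0P] := @small_forall 'I_k
      (fun j e => 0 < dot (p y) (v j) + e * dot w (v j)).
    by move=> j; apply: small_affine_gt0; rewrite pv; apply: yP.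
  left; exists (fun i => p y i + e0 * w i) => j; rewrite ltnS leq_eqVlt dot_linear.
  case/orP=> [/eqP->|jk]; first by rewrite pw add0r mulr_gt0.
  by apply: (e0P e0 _ (Ordinal jk)); rewrite e0_gt0 lexx.
pose s := \sum_(j < k) c j * (dot (v j) w / dot w w).
have sP i : \sum_(j < k) c j * v j i = s * w i.
  apply/eqP; rewrite -subr_eq0 /s mulr_suml -sumrB; apply/eqP; rewrite -[RHS](cP i).
  by apply: eq_bigr => j _; rewrite /p; ring.
have [s_le0|s_gt0] := leP s 0.
  right; exists (fun j => if j == k then - s else c j); split=> [j||i].
  - by case: eqP => //; rewrite oppr_ge0.
  - by exists j1; [exact: ltnW | rewrite ltn_eqF].
  - rewrite big_ord_recr /= eqxx mulNr -/w -sP -[RHS](subrr (\sum_(j < k) c j * v j i)).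
    by congr (_ - _); apply: eq_bigr => j _; rewrite ltn_eqF ?ltn_ord.
case: (IH v) => [[y yP]|[d [d0 [j2 j2k dj2] dP]]].
- left; exists y => j; rewrite ltnS leq_eqVlt => /orP[/eqP->|]; last exact: yP.
  rewrite -(pmulr_rgt0 _ s_gt0) -/w.
  have -> : s * dot y w = \sum_(j < k) c j * dot y (v j).
    under eq_bigr do rewrite dotC.
    rewrite -dot_sum /dot mulr_sumr; apply: eq_bigr => i _.
    by rewrite sP; ring.
  rewrite (bigD1 (Ordinal j1k)) //= ltr_wpDr ?mulr_gt0 ?yP //.
  by apply: sumr_ge0 => i _; rewrite mulr_ge0 // ltW // yP.
- right; exists (fun j => if j == k then 0 else d j); split=> [j||i].
  + by case: eqP.
  + by exists j2; [exact: ltnW | rewrite ltn_eqF].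
  + rewrite big_ord_recr /= eqxx mul0r addr0 -[RHS](dP i).
    by apply: eq_bigr => j _; rewrite ltn_eqF ?ltn_ord.
Qed.

Lemma gordan (I J : finType) (v : J -> I -> R) :
  (exists y, forall j, 0 < dot y (v j)) \/
  exists c : J -> R, [/\ forall j, 0 <= c j, exists j, 0 < c j &
    forall i, \sum_j c j * v j i = 0].
Proof.
have [j0|J0] := pickP (@predT J); last first.
  by left; exists (fun=> 0) => j; have := J0 j.
pose u n := v (nth j0 (enum J) n).
have uE j : u (index j (enum J)) = v j by rewrite /u nth_index ?mem_enum.
case: (gordan_nat #|J| u) => [[y yP]|[c [c0 [n nJ cn] cP]]].
  left; exists y => j; rewrite -uE; apply: yP.
  by rewrite cardE index_mem mem_enum.
right; exists (fun j => c (index j (enum J))); split=> [j||i0]; first exact: c0.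
  exists (nth j0 (enum J) n); rewrite index_uniq ?enum_uniq //.
  by rewrite -cardE.
rewrite -[RHS](cP i0) cardE -[LHS]big_enum /= (big_nth j0) big_mkord.
by apply: eq_bigr => m _; rewrite index_uniq ?enum_uniq.
Qed.

End Alternatives.

(** * The cone of totally balanced games *)

Section Cone.
Variables (R : realType) (N : finType).
Local Notation game := {ffun {set N} -> R^o}.
Implicit Types (m v a : game) (A S M : {set N}) (B : {set {set N}}).
Implicit Types (x y : N -> R) (c d : {set N} -> R).

Definition mass x A : R := \sum_(i in A) x i.

Lemma massE x A : mass x A = \sum_i (i \in A)%:R * x i.
Proof. by rewrite /mass big_mkcond; apply: eq_bigr => i _; case: ifP; rewrite ?mul1r ?mul0r. Qed.

Lemma mass0 x : mass x set0 = 0. Proof. by rewrite /mass big_set0. Qed.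

Lemma mass_affine x y (e : R) A :
  mass (fun i => x i + e * y i) A = mass x A + e * mass y A.
Proof. by rewrite /mass mulr_sumr -big_split. Qed.

Lemma mass_cst (e : R) A : mass (fun=> e) A = e * #|A|%:R.
Proof. by rewrite /mass sumr_const mulr_natr. Qed.

Lemma mass_scale x (e : R) A : mass (fun i => e * x i) A = e * mass x A.
Proof. by rewrite /mass mulr_sumr. Qed.

Lemma tilde0 m : tilde m set0 = 0. Proof. by rewrite ffunE subrr. Qed.

Lemma tilde_affine m v (e : R) S : tilde (m + e *: v) S = tilde m S + e * tilde v S.
Proof. by rewrite !ffunE /GRing.scale /=; ring. Qed.

(** Replaces vectors on the subtype of [A] by vectors on all of [N]; the value outside [A] is
    arbitrary since only subsets of [A] are weighed. *)
Lemma tb_coneP m : tb_cone m <-> forall A, A != set0 -> exists x,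
  mass x A = tilde m A /\ forall S, S \subset A -> tilde m S <= mass x S.
Proof.
have valT A : val @: [set: {i | i \in A}] = A.
  apply/setP=> i; apply/imsetP/idP=> [[j _ ->]|iA]; first exact: (valP j).
  by exists (Sub i iA).
have mass_val A y (S : {set {i | i \in A}}) :
    mass y (val @: S) = \sum_(j in S) y (val j).
  by rewrite /mass big_imset //= => j k _ _; apply: val_inj.
split=> mK A A0; have [x [xA xS]] := mK A A0.
  pose y i := if insub i is Some j then x j else 0.
  have yE (S : {set {i | i \in A}}) : mass y (val @: S) = \sum_(j in S) x j.
    by rewrite mass_val; apply: eq_bigr => j _; rewrite /y valK.
  exists y; split=> [|S SA].
    rewrite -{1}(valT A) yE; move: xA; rewrite ffunE valT => <-.
    by apply: eq_bigl => j; rewrite inE.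
  have SE : val @: [set j : {i | i \in A} | val j \in S] = S.
    apply/setP=> i; apply/imsetP/idP => [[j]|iS]; first by rewrite inE => ? ->.
    by exists (Sub i (subsetP SA _ iS)); rewrite ?inE.
  by move: (xS [set j : {i | i \in A} | val j \in S]); rewrite ffunE -yE SE.
exists [ffun j => x (val j)]; split=> [|S].
  rewrite ffunE valT -xA; transitivity (mass x (val @: [set: {i | i \in A}])).
    rewrite mass_val.
    by apply: eq_big => j; [rewrite inE | rewrite ffunE].
  by rewrite valT.
rewrite ffunE; under eq_bigr do rewrite ffunE.
rewrite -mass_val; apply: xS; apply/subsetP => i /imsetP[j _ ->]; exact: (valP j).
Qed.

Lemma tb_coneD m v : tb_cone m -> tb_cone v -> tb_cone (m + v).
Proof.
move=> /tb_coneP mK /tb_coneP vK; apply/tb_coneP => A A0.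
have [[x [xA xS]] [y [yA yS]]] := (mK A A0, vK A A0).
exists (fun i => x i + 1 * y i); split=> [|S SA]; rewrite -[v]scale1r tilde_affine mass_affine.
  by rewrite xA yA.
by rewrite !mul1r lerD ?xS ?yS.
Qed.

Lemma tb_cone0 : tb_cone (0 : game).
Proof.
have t0 S : tilde (0 : game) S = 0 by rewrite !ffunE subrr.
apply/tb_coneP => A _; exists (fun=> 0); rewrite mass_cst mul0r t0; split=> // S _.
by rewrite mass_cst mul0r t0.
Qed.

(** * Slack games as interior points *)

Definition slack m A := exists x, mass x A = tilde m A /\
  forall S, S != set0 -> S \proper A -> tilde m S < mass x S.

Lemma slack_feasible m A : slack m A -> exists x,
  mass x A = tilde m A /\ forall S, S \subset A -> tilde m S <= mass x S.
Proof.
move=> [x [xA xS]]; exists x; split=> // S.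
rewrite subEproper => /orP[/eqP->|SA]; first by rewrite xA.
by have [->|S0] := eqVneq S set0; [rewrite tilde0 mass0 | rewrite ltW ?xS].
Qed.

Lemma slack_tb_cone m : (forall A, A != set0 -> slack m A) -> tb_cone m.
Proof. by move=> H; apply/tb_coneP => A /H/slack_feasible. Qed.

Lemma slack_small m v A : slack m A -> A != set0 ->
  exists2 e0 : R, 0 < e0 & forall e, 0 < e <= e0 -> slack (m + e *: v) A.
Proof.
move=> [x [xA xS]] A0.
have cA : #|A|%:R != 0 :> R by rewrite pnatr_eq0 cards_eq0.
(* Spreading [tilde v A] evenly over [A] preserves the equality at [A]; the finitely many strict
   inequalities survive for small [e]. *)
pose y : N -> R := fun=> tilde v A / #|A|%:R.
have [|e0 e0_gt0 e0P] := @small_forall R {set N} (fun S e => S != set0 ->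
    S \proper A -> 0 < mass x S - tilde m S + e * (mass y S - tilde v S)).
  move=> S; have [->|S0] := eqVneq S set0; first by exists 1.
  have [SA|SA] := boolP (S \proper A); last by exists 1 => // e _ _ H; rewrite H in SA.
  have [|e e_gt0 eP] := @small_affine_gt0 R (mass x S - tilde m S) (mass y S - tilde v S).
    by rewrite subr_gt0 xS.
  by exists e => // f /eP.
exists e0 => // e /e0P eP; exists (fun i => x i + e * y i).
split=> [|S S0 SA]; rewrite tilde_affine mass_affine.
  by rewrite xA {1}/y mass_cst divfK.
have := eP S S0 SA; lra.
Qed.

Lemma slack_small_tb_cone m v : (forall A, A != set0 -> slack m A) ->
  exists2 e : R, 0 < e & tb_cone (m + e *: v).
Proof.
move=> mS; have [|e e0 eP] := @small_forall R {set N} (fun A e => A != set0 -> slack (m + e *: v) A).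
  move=> A; have [->|A0] := eqVneq A set0; first by exists 1.
  have [e e0 eP] := slack_small v (mS A A0) A0; exists e => // f /eP; exact.
by exists e => //; apply: slack_tb_cone => A; apply: eP; rewrite e0 lexx.
Qed.

(** A concrete interior point: giving each player weight [#|A|] yields [#|A| * #|S|], which exceeds
    [#|S| ^ 2] on nonempty proper subsets of [A]. *)
Definition square_game : game := [ffun S : {set N} => #|S|%:R ^+ 2].

Lemma square_slack A : A != set0 -> slack square_game A.
Proof.
have tE S : tilde square_game S = #|S|%:R ^+ 2 by rewrite !ffunE cards0 expr0n subr0.
move=> A0; exists (fun=> #|A|%:R); split=> [|S S0 SA]; rewrite mass_cst tE ?expr2//.
by rewrite ltr_pM2r ?ltr_nat ?proper_card // ltr0n card_gt0.
Qed.

(** * Linear functionals and their hyperplanes *)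

Lemma scalar_prodC a v : scalar_prod a v = scalar_prod v a.
Proof. by apply: eq_bigr => S _; rewrite mulrC. Qed.

Fact scalar_prod_is_linear a : linear (scalar_prod a : game -> R^o).
Proof.
move=> e m v; rewrite /scalar_prod scaler_sumr -big_split; apply: eq_bigr => S _.
by rewrite !ffunE /GRing.scale /=; ring.
Qed.
HB.instance Definition _ a :=
  GRing.isLinear.Build R game R^o *:%R (scalar_prod a) (scalar_prod_is_linear a).

Lemma scalar_prod_affine a m v (e : R) :
  scalar_prod a (m + e *: v) = scalar_prod a m + e * scalar_prod a v.
Proof. by rewrite linearD linearZ. Qed.

Lemma scalar_prodZl a m (e : R) : scalar_prod (e *: a) m = e * scalar_prod a m.
Proof. by rewrite scalar_prodC linearZ /= scalar_prodC. Qed.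

Lemma scalar_prod_self_gt0 a : a != 0 -> 0 < scalar_prod a a.
Proof.
move=> a0; suff [S aS] : exists S, a S != 0 by apply: (@dot_self_gt0 R _ a S).
apply: contrapT => H; case/eqP: a0; apply/ffunP => S; rewrite ffunE.
by apply/eqP/negP => /negP aS; apply: H; exists S.
Qed.

(** A short step from [m] along [- a] stays in the cone and lowers the functional by a positive
    multiple of its value at [a]. *)
Lemma valid_slack_gt0 a m : valid_ineq (@tb_cone R N) a -> a != 0 ->
  (forall A, A != set0 -> slack m A) -> 0 < scalar_prod a m.
Proof.
move=> aV a0 mS; have [e e0 eK] := slack_small_tb_cone (- a) mS.
have := aV _ eK; rewrite scalar_prod_affine linearN mulrN subr_ge0.
by apply: lt_le_trans; rewrite mulr_gt0 ?scalar_prod_self_gt0.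
Qed.

Definition hyperplane a : {vspace game} := lker (linfun (scalar_prod a : game -> R^o)).

Lemma mem_hyperplane a v : (v \in hyperplane a) = (scalar_prod a v == 0).
Proof. by rewrite memv_ker lfunE. Qed.

(** Rank-nullity: the image is a subspace of the line [R^o], nonzero because the functional is
    positive at [a]. *)
Lemma dim_hyperplane a : a != 0 -> (\dim (hyperplane a)).+1 = \dim {:game}.
Proof.
move=> a0; rewrite -(limg_ker_dim (linfun (scalar_prod a : game -> R^o)) fullv) capfv -/(hyperplane a) -addn1.
congr addn; apply/anti_leq/andP; split; last first.
  by rewrite (leq_trans (dimvS (subvf _))) ?dimvf.
rewrite lt0n dimv_eq0; apply/eqP => L0.
have := memv_img (linfun (scalar_prod a : game -> R^o)) (memvf a).
by rewrite L0 memv0 lfunE gt_eqF // scalar_prod_self_gt0.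
Qed.

(** * Balanced systems and their inequalities *)

Lemma sum_delta (T : finType) (f : T -> R) (t : T) : \sum_s (s == t)%:R * f s = f t.
Proof.
rewrite (bigD1 t) //= eqxx mul1r big1 ?addr0 // => s /negbTE->; exact: mul0r.
Qed.

Definition balances c A := forall i, \sum_S c S * (i \in S)%:R = (i \in A)%:R.

(** The unscaled form of [alpha_of], for arbitrary coefficients. The entry at [set0] makes all
    entries sum to zero, so that a game enters only through [tilde]. *)
Definition bal_ineq A c : game :=
  [ffun S : {set N} => (S == A)%:R - c S + (S == set0)%:R * (\sum_T c T - 1)].

Lemma scalar_prod_bal A c m :
  scalar_prod (bal_ineq A c) m = tilde m A - \sum_S c S * tilde m S.
Proof.
transitivity (\sum_S ((S == A)%:R * m S - c S * m S +
    (S == set0)%:R * ((\sum_T c T - 1) * m S))).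
  by apply: eq_bigr => S _; rewrite ffunE; ring.
rewrite big_split sumrB /= !sum_delta ffunE.
under [in RHS]eq_bigr do rewrite ffunE mulrBr.
by rewrite sumrB -mulr_suml; ring.
Qed.

Lemma chi_coneP B A : chi_cone B (chi R A) <->
  exists c, [/\ forall S, 0 <= c S, forall S, S \notin B -> c S = 0 & balances c A].
Proof.
split=> [[c c0 cE]|[c [c0 cB cA]]]; last first.
  exists c => [S _|]; first exact: c0.
  apply/ffunP => i; rewrite sum_ffunE ffunE -cA [RHS]big_mkcond /=; apply: eq_bigr => S _.
  by case: ifPn => [_|/cB->]; rewrite ?mul0r // !ffunE.
exists (fun S => if S \in B then c S else 0); split=> [S|S /negbTE->|i] //.
  by case: ifP => // /c0.
move/ffunP/(_ i): cE; rewrite sum_ffunE ffunE => ->; rewrite [RHS]big_mkcond /=.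
by apply: eq_bigr => S _; case: ifP => _; rewrite ?mul0r // !ffunE.
Qed.

Lemma balances_mass c A x : balances c A -> \sum_S c S * mass x S = mass x A.
Proof.
move=> cA; rewrite massE; under eq_bigr do rewrite massE mulr_sumr.
rewrite exchange_big; apply: eq_bigr => i _; rewrite -cA mulr_suml.
by apply: eq_bigr => S _; rewrite mulrA.
Qed.

Lemma balances_sub c A S : (forall T, 0 <= c T) -> balances c A -> c S != 0 -> S \subset A.
Proof.
move=> c0 cA cS; apply/subsetP => i iS; apply: contraT => iA.
have /eqP := cA i; rewrite (negbTE iA) psumr_eq0 => [/allP/(_ S)|T _]; last first.
  by rewrite mulr_ge0.
by rewrite mem_index_enum iS mulr1 (negbTE cS) => /(_ isT).
Qed.

Lemma balances_affine c d A A' (e : R) : balances c A -> balances d A' ->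
  forall i, \sum_S (c S + e * d S) * (i \in S)%:R = (i \in A)%:R + e * (i \in A')%:R.
Proof.
move=> cA dA i; rewrite -cA -dA mulr_sumr -big_split.
by apply: eq_bigr => S _; rewrite /= mulrDl mulrA.
Qed.

(** Weight the core inequalities at [A] by [c] and sum: the masses add up to that of [A]. *)
Lemma valid_bal A c : (forall S, 0 <= c S) -> balances c A -> A != set0 ->
  valid_ineq (@tb_cone R N) (bal_ineq A c).
Proof.
move=> c0 cA A0 m /tb_coneP/(_ A A0)[x [xA xS]].
rewrite scalar_prod_bal subr_ge0 -xA -(balances_mass x cA); apply: ler_sum => S _.
have [->|cS] := eqVneq (c S) 0; first by rewrite !mul0r.
by rewrite ler_wpM2l // xS // (balances_sub c0 cA cS).
Qed.

Lemma balances_cover c B A : (forall S, 0 <= c S) -> balances c A ->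
  (forall S, (S \in B) = (0 < c S)) -> cover B = A.
Proof.
move=> c0 cA cB; apply/eqP; rewrite eqEsubset; apply/andP; split.
  by apply/bigcupsP => S; rewrite cB => cS; apply: (balances_sub c0 cA); rewrite gt_eqF.
apply/subsetP => i iA; apply/bigcupP; apply: contrapT => H.
have := cA i; rewrite iA big1 => [/esym/eqP|S _]; first by rewrite oner_eq0.
have [iS|_] := boolP (i \in S); last by rewrite mulr0.
have [cS|cS] := ltP 0 (c S); first by case: H; exists S; rewrite ?cB.
by have /eqP-> : c S == 0; rewrite ?mul0r // eq_le cS c0.
Qed.

(** * Min-balanced systems: independence and rational coefficients *)

Section MinBalanced.
Variable B : {set {set N}}.
Hypothesis B_mb : min_balanced R B.
Local Notation M := (cover B).

(** A coefficient vanishing at [S] would let [B :\ S] generate the carrier, against minimality. *)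
Lemma min_balanced_pos c : (forall S, 0 <= c S) -> (forall S, S \notin B -> c S = 0) ->
  balances c M -> forall S, S \in B -> 0 < c S.
Proof.
case: B_mb => _ _ Bmin c0 cB cM S SB; rewrite lt0r c0 andbT; apply/eqP => cS.
apply: (Bmin (B :\ S)); first exact: properD1.
apply/chi_coneP; exists c; split=> // T; rewrite !inE negb_and negbK.
by case/orP => [/eqP->//|/cB].
Qed.

Lemma lambdaP : [/\ forall S, 0 <= lambda R B S, forall S, S \in B -> 0 < lambda R B S,
  forall S, S \notin B -> lambda R B S = 0 & balances (lambda R B) M].
Proof.
have : balancing_coefs B (lambda R B).
  apply: xgetPex; case: B_mb => _ /chi_coneP[c [c0 cB cM]] _.
  exists [ffun S => c S]; split=> [S SB|S SB|].
  - by rewrite ffunE; apply: (min_balanced_pos c0).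
  - by rewrite ffunE cB.
  - apply/ffunP => i; rewrite sum_ffunE ffunE -cM [RHS]big_mkcond /=; apply: eq_bigr => S _.
    by case: ifPn => [_|/cB->]; rewrite ?mul0r // !ffunE.
case=> l0 lB lM; split=> // [S|i]; first by have [/l0/ltW|/lB->] := boolP (S \in B).
move/ffunP/(_ i): lM; rewrite sum_ffunE ffunE => ->; rewrite [RHS]big_mkcond /=.
by apply: eq_bigr => S _; case: ifPn => [_|/lB->]; rewrite ?mul0r // !ffunE.
Qed.

(* Moving lambda along a linear dependency until a coefficient vanishes would
   contradict minimality. *)
Lemma min_balanced_free d : (forall S, S \notin B -> d S = 0) ->
  (forall i, \sum_S d S * (i \in S)%:R = 0) -> forall S, d S = 0.
Proof.
have [l0 lpos lB lM] := lambdaP.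
have no_pos d' S0 : (forall S, S \notin B -> d' S = 0) ->
    (forall i, \sum_S d' S * (i \in S)%:R = 0) -> ~ 0 < d' S0.
  move=> dB d0 dS0; have [S1 dS1 ge0] := ratio_test l0 dS0.
  set t := (X in forall s, 0 <= _ - X * _) in ge0.
  have S1B : S1 \in B by apply: contraTT dS1 => /dB->; rewrite ltxx.
  suff /(_ _ S1B) : forall S, S \in B -> 0 < lambda R B S - t * d' S.
    by rewrite /t divfK ?gt_eqF // subrr ltxx.
  apply: min_balanced_pos => // [S SB|i]; first by rewrite lB ?dB // mulr0 subr0.
  under eq_bigr do rewrite mulrBl -mulrA.
  by rewrite sumrB -mulr_sumr d0 mulr0 subr0 lM.
move=> dB d0 S; apply/eqP; rewrite eq_le !leNgt; apply/andP; split; apply/negP; first exact: no_pos.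
rewrite -oppr_gt0; apply: (no_pos (fun S => - d S)) => [T /dB->|i]; first by rewrite oppr0.
by under eq_bigr do rewrite mulNr; rewrite sumrN d0 oppr0.
Qed.

Lemma lambda_unique c : (forall S, S \notin B -> c S = 0) -> balances c M ->
  forall S, c S = lambda R B S.
Proof.
have [_ _ lB lM] := lambdaP => cB cM S; apply/eqP; rewrite -subr_eq0; apply/eqP.
apply: (min_balanced_free (d := fun S => c S - lambda R B S)) => [T TB|i].
  by rewrite cB ?lB // subrr.
by under eq_bigr do rewrite mulrBl; rewrite sumrB cM lM subrr.
Qed.

(** The incidence vector of [set0] is zero, a linear dependency by itself. *)
Lemma set0_notin_min_balanced : set0 \notin B.
Proof.
apply/negP => B0; suff /eqP : ((set0 : {set N}) == set0)%:R = 0 :> R.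
  by rewrite eqxx oner_eq0.
apply: (min_balanced_free (d := fun S => (S == set0)%:R)) => [S SB|i].
  by case: eqP SB => // ->; rewrite B0.
by rewrite sum_delta inE.
Qed.

Lemma min_balanced_cover_neq0 : M != set0.
Proof.
case: B_mb => /set0Pn[S SB] _ _; apply: contraNneq set0_notin_min_balanced => M0.
have : S \subset M by apply: (bigcup_sup S).
by rewrite M0 subset0 => /eqP <-.
Qed.

Lemma cover_notin_min_balanced : nontrivial B -> M \notin B.
Proof.
move=> Bnt; apply/negP => MB; case: B_mb => _ _ /(_ [set M]) H; apply: H.
  by rewrite properEcard sub1set MB cards1.
apply/chi_coneP; exists (fun S => (S == M)%:R); split=> [S|S|i]; first exact: ler0n.
  by rewrite inE => /negbTE->.
exact: sum_delta.
Qed.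

(** The field is a parameter because the matrix is used over both [R] and [rat]. *)
Definition chi_mx (F : fieldType) : 'M[F]_(#|B|, #|N|) :=
  \matrix_(i < #|B|, j < #|N|) (enum_val j \in (enum_val i : {set N}))%:R.

Lemma mul_row_chi_mx (f : {set N} -> R) j :
  ((\row_i f (enum_val i)) *m chi_mx R) 0 j = \sum_(S in B) f S * (enum_val j \in S)%:R.
Proof. by rewrite mxE [RHS]big_enum_val; apply: eq_bigr => i _; rewrite !mxE. Qed.

Lemma chi_mx_free : row_free (chi_mx R).
Proof.
apply: inj_row_free => u u0.
pose d S : R := \sum_i (S == enum_val i)%:R * u 0 i.
have dE i : d (enum_val i) = u 0 i.
  rewrite -[RHS](sum_delta (fun i => u 0 i)); apply: eq_bigr => j _.
  by rewrite (inj_eq enum_val_inj) eq_sym.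
have uE : u = \row_i d (enum_val i) by apply/rowP => i; rewrite mxE dE.
have dB S : S \notin B -> d S = 0.
  move=> SB; rewrite /d big1 // => i _; case: eqP => [SE|]; last by rewrite mul0r.
  by rewrite SE enum_valP in SB.
suff d0 S : d S = 0 by apply/rowP => i; rewrite -dE d0 mxE.
apply: min_balanced_free S => // n; rewrite uE in u0.
transitivity (\sum_(S in B) d S * (n \in S)%:R).
  by rewrite [RHS]big_mkcond /=; apply: eq_bigr => S _; case: ifPn => // /dB->; rewrite mul0r.
by rewrite -[n]enum_rankK -mul_row_chi_mx u0 mxE.
Qed.

(** Independent rows give the incidence matrix a right inverse. *)
Lemma min_balanced_interpolation (f : {set N} -> R) :
  exists y, forall S, S \in B -> mass y S = f S.
Proof.
have /row_freeP[Y XY] := chi_mx_free.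
pose z := Y *m \col_i f (enum_val i).
have Xz : chi_mx R *m z = \col_i f (enum_val i) by rewrite mulmxA XY mul1mx.
exists (fun n => z (enum_rank n) 0) => S SB.
transitivity ((chi_mx R *m z) (enum_rank_in SB S) 0); last by rewrite Xz mxE enum_rankK_in.
rewrite mxE massE (reindex (fun j : 'I_#|N| => enum_val j)) /=; last by apply: onW_bij; apply: enum_val_bij.
by apply: eq_bigr => j _; rewrite [chi_mx R _ _]mxE enum_rankK_in // enum_valK.
Qed.

(** Solvability of a linear system with 0/1 entries does not depend on the field, so a rational
    solution exists; independence over [R] identifies it with [lambda]. *)
Lemma lambda_rat S : exists q : rat, lambda R B S = ratr q.
Proof.
have [_ _ lB lM] := lambdaP.
have [SB|/lB->] := boolP (S \in B); last by exists 0; rewrite rmorph0.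
pose r (F : fieldType) : 'rV[F]_#|N| := \row_j (enum_val j \in M)%:R.
have rE : r R = (\row_i lambda R B (enum_val i)) *m chi_mx R.
  apply/rowP => j; rewrite mul_row_chi_mx mxE -lM big_mkcond [RHS]big_mkcond /=.
  by apply: eq_bigr => T _; case: ifPn => // /lB->; rewrite mul0r.
have rQ : r R = map_mx ratr (r rat) by apply/rowP => j; rewrite !mxE rmorph_nat.
have XQ : chi_mx R = map_mx ratr (chi_mx rat) by apply/matrixP => i j; rewrite !mxE rmorph_nat.
have /submxP[u uE] : (r rat <= chi_mx rat)%MS.
  by rewrite -(map_submx (ratr : {rmorphism rat -> R})) -rQ -XQ rE submxMl.
exists (u 0 (enum_rank_in SB S)).
have /(row_free_inj chi_mx_free)/rowP/(_ (enum_rank_in SB S)) :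
    (\row_i lambda R B (enum_val i)) *m chi_mx R = map_mx ratr u *m chi_mx R.
  by rewrite -rE rQ uE map_mxM /= -XQ.
by rewrite !mxE enum_rankK_in.
Qed.

(** The product of all denominators clears them, so the default 0 of [xget] is not taken. *)
Lemma least_multiplier_gt0 : (0 < least_multiplier R B)%N.
Proof.
have /choice[q qE] := lambda_rat.
have ex_k : exists k, `[< clears_denominators R B k >].
  exists (\prod_S `|denq (q S)|)%N; apply/asboolP; split.
    by rewrite prodn_gt0 // => S; rewrite absz_gt0 denq_neq0.
  move=> S _; rewrite qE (bigD1 S) //= mulnC natrM -mulrA rpredM ?rpred_nat //.
  have -> : `|denq (q S)|%:R * ratr (q S) = (numq (q S))%:~R :> R.
    rewrite -{2}(divq_num_den (q S)) fmorph_div /= !ratr_int pmulrn absz_denq.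
    by rewrite mulrC divfK // intr_eq0 denq_neq0.
  exact: intr_int.
have [k kP k_min] := find_ex_minn ex_k.
suff /(xgetPex 0%N)[[]] : exists k, (clears_denominators R B k /\
    forall j, clears_denominators R B j -> (k <= j)%N) by [].
by exists k; split=> [|j jP]; [apply/asboolP | apply/k_min/asboolP].
Qed.

Lemma alpha_ofE : nontrivial B ->
  alpha_of R B = (least_multiplier R B)%:R *: bal_ineq M (lambda R B).
Proof.
move=> /cover_notin_min_balanced MB; have [_ _ lB _] := lambdaP.
apply/ffunP => S; rewrite !ffunE /GRing.scale /=.
have [->|SM] := eqVneq S M.
  by rewrite lB // (negbTE min_balanced_cover_neq0) subr0 mul0r addr0 mulr1.
have [SB|SB] := boolP (S \in B).
  have /negbTE-> : S != set0 by apply: contraTneq SB => ->; exact: set0_notin_min_balanced.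
  by rewrite mul0r addr0 sub0r mulrN.
rewrite lB // subrr add0r; case: eqP => _; last by rewrite mul0r mulr0.
rewrite mul1r mulrBr mulr1 addrC; congr (_ * _ - _); rewrite big_mkcond /=.
by apply: eq_bigr => T _; case: ifPn => // /lB.
Qed.

Lemma valid_alpha_of : nontrivial B -> valid_ineq (@tb_cone R N) (alpha_of R B).
Proof.
have [l0 _ _ lM] := lambdaP => Bnt m mK.
rewrite alpha_ofE // scalar_prodZl.
by rewrite mulr_ge0 ?ler0n // (valid_bal l0 lM min_balanced_cover_neq0 mK).
Qed.

Lemma alpha_of_cover : nontrivial B -> 0 < alpha_of R B M.
Proof. by move=> Bnt; rewrite ffunE eqxx ltr0n least_multiplier_gt0. Qed.

Lemma alpha_of_neq0 : nontrivial B -> alpha_of R B != 0.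
Proof. by move/alpha_of_cover; apply: contraTneq => ->; rewrite ffunE ltxx. Qed.

End MinBalanced.

(** * From failure of slackness to a tight min-balanced system *)

Lemma not_slack_tight m A : tb_cone m -> A != set0 -> ~ slack m A ->
  exists c, [/\ forall S, 0 <= c S,
    forall S, ~~ ((S != set0) && (S \proper A)) -> c S = 0, balances c A &
    scalar_prod (bal_ineq A c) m = 0].
Proof.
move=> mK A0 mA; pose good S := (S != set0) && (S \proper A).
have cA : 0 < #|A|%:R :> R by rewrite ltr0n card_gt0.
have cAn0 : #|A|%:R != 0 :> R by rewrite gt_eqF.
(* Subtracting [q S] times the data at [A] eliminates the equation at [A]: the resulting inequality
   does not change when a constant is added to the vector. *)
pose q S : R := #|S|%:R / #|A|%:R.
(* The last coordinate homogenizes the system; the sets that are not good all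
   carry the vector forcing the homogenizing variable to be positive. *)
pose v S (i : N + unit) : R := match i with
  | inl n => if good S then (n \in S)%:R - q S * (n \in A)%:R else 0
  | inr _ => if good S then q S * tilde m A - tilde m S else 1 end.
have sum_I (f : N + unit -> R) : \sum_i f i = \sum_n f (inl n) + f (inr tt).
  by rewrite big_sumType /= (bigD1 tt) //= [X in _ + (_ + X)]big1 ?addr0 // => -[].
have [[y yP]|[c [c0 [S0 cS0] cP]]] := gordan v.
  case: mA; pose x n := y (inl n); pose z := y (inr tt).
  have z0 : 0 < z.
    have := yP set0; rewrite /dot sum_I /v /good eqxx /= mulr1 big1 ?add0r // => n _.
    exact: mulr0.
  (* Dehomogenize by [z], then shift by the constant that gives [A] the required mass. *)
  exists (fun n => (tilde m A - mass x A / z) / #|A|%:R + z^-1 * x n).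
  split=> [|S S0 SA]; rewrite mass_affine mass_cst.
    by field; rewrite cAn0 gt_eqF.
  have gS : good S by rewrite /good S0.
  have -> : (tilde m A - mass x A / z) / #|A|%:R * #|S|%:R + z^-1 * mass x S =
      tilde m S + z^-1 * (mass x S - q S * mass x A + z * (q S * tilde m A - tilde m S)).
    by rewrite /q; field; rewrite cAn0 gt_eqF.
  rewrite ltrDl mulr_gt0 ?invr_gt0 //; have := yP S; rewrite /dot sum_I /v gS.
  congr (0 < _ + _); rewrite !massE mulr_sumr -sumrB; apply: eq_bigr => n _.
  by rewrite /x; ring.
pose g S := if good S then c S else 0; pose b S := if good S then 0 else c S.
have g0 S : 0 <= g S by rewrite /g; case: ifP.
have b0 S : 0 <= b S by rewrite /b; case: ifP.
pose t := \sum_S g S * q S.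
have q0 S : 0 <= q S by rewrite /q divr_ge0 ?ler0n.
have gE n : \sum_S g S * (n \in S)%:R = t * (n \in A)%:R.
  apply/eqP; rewrite -subr_eq0 mulr_suml -sumrB; apply/eqP; rewrite -[RHS](cP (inl n)).
  by apply: eq_bigr => S _; rewrite /g /v; case: ifP => _; ring.
have bE : \sum_S b S = \sum_S g S * tilde m S - t * tilde m A.
  apply/eqP; rewrite -subr_eq0 mulr_suml -!sumrB; apply/eqP; rewrite -[RHS](cP (inr tt)).
  by apply: eq_bigr => S _; rewrite /g /b /v; case: ifP => _; ring.
(* If [t] were 0, then [g] would vanish since [q] is positive on good sets; [bE] would then
   annihilate [b], hence all of [c]. *)
have t_gt0 : 0 < t.
  rewrite lt0r sumr_ge0 ?andbT => [|S _]; last by rewrite mulr_ge0.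
  apply/eqP => /eqP; rewrite psumr_eq0 => [/allP gq|S _]; last by rewrite mulr_ge0.
  have gS S : g S = 0.
    have /eqP/eqP := gq S (mem_index_enum _); rewrite /= mulf_eq0 => /orP[/eqP//|].
    rewrite /g /good; case: ifP => // /andP[S0' _].
    by rewrite /q mulf_eq0 invr_eq0 (negbTE cAn0) pnatr_eq0 cards_eq0 (negbTE S0').
  have t0 : t = 0 by rewrite /t big1 // => S _; rewrite gS mul0r.
  move: bE; rewrite t0 mul0r subr0 [RHS]big1 => [/eqP|S _]; last by rewrite gS mul0r.
  rewrite psumr_eq0 // => /allP/(_ S0 (mem_index_enum _)).
  have := gS S0; rewrite /g /b; case: ifP => _ cz; last by rewrite gt_eqF.
  by rewrite cz ltxx in cS0.
have dA : balances (fun S => g S / t) A.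
  move=> n; under eq_bigr do rewrite mulrAC.
  by rewrite -mulr_suml gE mulrAC divff ?mul1r // gt_eqF.
have d0 S : 0 <= g S / t by rewrite divr_ge0 // ltW.
exists (fun S => g S / t); split=> // [S /negbTE|]; first by rewrite /g -/(good S) => ->; rewrite mul0r.
(* Validity gives one inequality; the other is nonnegativity of the sum of [b]. *)
apply/eqP; rewrite eq_le (valid_bal d0 dA A0 mK) andbT scalar_prod_bal subr_le0.
under eq_bigr do rewrite mulrAC.
by rewrite -mulr_suml ler_pdivlMr // mulrC -subr_ge0 -bE sumr_ge0.
Qed.

(** Induction on the support of [c]. If a proper subsystem carries a balancing [d], subtract from
    [c] the largest admissible multiple of [d] and renormalize: the result is still tight and has
    smaller support. A minimal support is min-balanced, with [c] equal to [lambda]. *)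
Lemma tight_min_balanced m A c : tb_cone m -> A != set0 ->
  (forall S, 0 <= c S) -> (forall S, ~~ ((S != set0) && (S \proper A)) -> c S = 0) ->
  balances c A -> scalar_prod (bal_ineq A c) m = 0 ->
  exists B, [/\ nontrivial B, min_balanced R B & scalar_prod (alpha_of R B) m = 0].
Proof.
move=> mK A0; have [n] := ubnP #|[set S | 0 < c S]|.
elim: n c => // n IH c; rewrite ltnS => le_n c0 cgood cA cm.
pose B := [set S | 0 < c S].
have inB S : (S \in B) = (0 < c S) by rewrite inE.
have BA : cover B = A := balances_cover c0 cA inB.
have Bgood S : S \in B -> (S != set0) && (S \proper A).
  by rewrite inB; apply: contraTT => /cgood->; rewrite ltxx.
have [[B' [B'B /chi_coneP[d [d0 dB' dA]]]]|Bmin] := pselect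
    (exists B' : {set {set N}}, B' \proper B /\ chi_cone B' (chi R A)).
  have [S1 dS1 ge0] : exists2 s1, 0 < d s1 & forall s, 0 <= c s - c s1 / d s1 * d s.
    have [S0 dS0|d_le0] := pickP (fun S => 0 < d S); first exact: ratio_test c0 dS0.
    case/set0Pn: A0 => i iA; have := dA i; rewrite iA big1 => [/eqP|S _].
      by rewrite eq_sym oner_eq0.
    have := d_le0 S; rewrite lt0r d0 andbT => /negbFE/eqP->; exact: mul0r.
  set t := c S1 / d S1 in ge0.
  have t0 : 0 <= t by rewrite divr_ge0.
  (* Otherwise [c - d] is nonnegative and its combination of incidence vectors vanishes, which is
     impossible at a nonempty set of [B] outside [B']. *)
  have t1 : t < 1.
    rewrite ltNge; apply/negP => t_ge1; case/properP: B'B => _ [S SB SB'].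
    have /andP[/set0Pn[i iS] _] := Bgood S SB.
    have cd T : 0 <= c T - d T by rewrite (le_trans (ge0 T)) // lerD2l lerN2 ler_peMl.
    have : \sum_T (c T - d T) * (i \in T)%:R == 0.
      by under eq_bigr do rewrite mulrBl; rewrite sumrB cA dA subrr.
    rewrite psumr_eq0 => [/allP/(_ S (mem_index_enum _))|T _]; last by rewrite mulr_ge0.
    by rewrite iS mulr1 dB' // subr0 gt_eqF -?inB.
  have s0 : 0 < 1 - t by rewrite subr_gt0.
  pose e S := (c S + (- t) * d S) / (1 - t).
  have e0 S : 0 <= e S by rewrite divr_ge0 ?(ltW s0) // mulNr.
  have eA : balances e A.
    move=> i; under eq_bigr do rewrite mulrAC.
    rewrite -mulr_suml (balances_affine (- t) cA dA) mulNr -{1}[(i \in A)%:R]mul1r -mulrBl.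
    by rewrite mulrAC divff ?mul1r // gt_eqF.
  have e_supp S : c S = 0 -> e S = 0.
    move=> cS; suff dS : d S = 0 by rewrite /e cS dS mulr0 addr0 mul0r.
    apply: dB'; apply/negP => SB'; have := subsetP (proper_sub B'B) _ SB'.
    by rewrite inB cS ltxx.
  apply: (IH e) => // [|S /cgood/e_supp//|].
    apply: leq_trans le_n; apply: proper_card; apply/properP; split.
      apply/subsetP => S; rewrite !inE; apply: contraTT; rewrite -leNgt => cS.
      by rewrite e_supp ?ltxx //; apply/eqP; rewrite eq_le cS c0.
    have S1B' : S1 \in B' by apply: contraTT dS1 => /dB'->; rewrite ltxx.
    exists S1; first exact: subsetP (proper_sub B'B) _ S1B'.
    by rewrite inE /e /t mulNr divfK ?subrr ?mul0r ?ltxx // gt_eqF.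
  (* As [c] is [(1 - t) e + t d], tightness at [c] and validity at [d] bound the value at [e] above
     by 0. *)
  apply/eqP; rewrite eq_le (valid_bal e0 eA A0 mK) andbT -(pmulr_rle0 _ s0).
  have := valid_bal d0 dA A0 mK; have := cm; rewrite !scalar_prod_bal.
  have -> : \sum_S e S * tilde m S =
      (\sum_S c S * tilde m S - t * \sum_S d S * tilde m S) / (1 - t).
    rewrite mulr_sumr -sumrB mulr_suml; apply: eq_bigr => S _.
    by rewrite /e; field; rewrite gt_eqF.
  move=> cm0 dm0; rewrite mulrBr mulrCA divff ?gt_eqF // mulr1.
  have : 0 <= t * (tilde m A - \sum_S d S * tilde m S) by rewrite mulr_ge0.
  lra.
have B0 : B != set0.
  apply: contra_neq A0 => B0; rewrite -BA B0; apply/eqP; rewrite -subset0.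
  by apply/bigcupsP => S; rewrite inE.
have B_mb : min_balanced R B.
  split=> // [|B' B'B]; rewrite BA; last by move=> H; apply: Bmin; exists B'.
  apply/chi_coneP; exists c; split=> // S; rewrite inB => cS; apply/eqP.
  by rewrite eq_le c0 andbT leNgt.
have Bnt : nontrivial B.
  rewrite /nontrivial ltn_neqAle card_gt0 B0 andbT; apply/eqP => /esym/eqP/cards1P[S BS].
  have /andP[_] : (S != set0) && (S \proper A) by apply: Bgood; rewrite BS inE.
  by rewrite -BA BS cover1 properxx.
have cl S : c S = lambda R B S.
  apply: lambda_unique => // [T|]; last by rewrite BA.
  by rewrite inB => cT; apply/eqP; rewrite eq_le c0 andbT leNgt.
exists B; split=> //; rewrite alpha_ofE // scalar_prodZl BA.
move: cm; rewrite !scalar_prod_bal; under eq_bigr do rewrite cl.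
by move=> ->; rewrite mulr0.
Qed.

(** * Separation for irreducible systems *)

(** Gordan's alternative for the members of [P] together with the negative of [chi A]. A dependency
    either puts [chi A] in the cone or is a nonnegative combination of nonempty sets equal to
    zero. *)
Lemma separating_vector (P : {set {set N}}) A : A != set0 -> set0 \notin P ->
  ~ chi_cone P (chi R A) ->
  exists y, mass y A = -1 /\ forall S, S \in P -> 0 < mass y S.
Proof.
move=> A0 P0 PA.
have AP : A \notin P.
  apply/negP => AP; apply: PA; apply/chi_coneP; exists (fun S => (S == A)%:R).
  split=> [S|S SP|i]; [exact: ler0n | | exact: sum_delta].
  by case: eqP SP => // ->; rewrite AP.
(* All sets outside [P], among them [A], carry the same vector, so the index type can be
   [{set N}]. *)
pose v S (i : N) : R := if S \in P then (i \in S)%:R else - (i \in A)%:R.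
have [[y yP]|[c [c0 [S0 cS0] cP]]] := gordan v.
  have yA : 0 < - mass y A.
    have := yP A; rewrite /dot /v (negbTE AP) massE -sumrN; congr (0 < _).
    by apply: eq_bigr => i _; ring.
  exists (fun i => (- mass y A)^-1 * y i); rewrite mass_scale; split=> [|S SP].
    by rewrite invrN mulNr mulVf // -oppr_eq0 gt_eqF.
  rewrite mass_scale mulr_gt0 ?invr_gt0 //; have := yP S; rewrite /dot /v SP massE.
  by congr (0 < _); apply: eq_bigr => i _; rewrite mulrC.
pose g S := if S \in P then c S else 0; pose b S := if S \in P then 0 else c S.
have g0 S : 0 <= g S by rewrite /g; case: ifP.
have b0 S : 0 <= b S by rewrite /b; case: ifP.
have gE i : \sum_S g S * (i \in S)%:R = (\sum_S b S) * (i \in A)%:R.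
  apply/eqP; rewrite -subr_eq0 mulr_suml -sumrB; apply/eqP; rewrite -[RHS](cP i).
  by apply: eq_bigr => S _; rewrite /g /b /v; case: ifP => _; ring.
have [t0|t0] := eqVneq (\sum_S b S) 0; last first.
  have t_gt0 : 0 < \sum_S b S by rewrite lt0r t0 sumr_ge0.
  case: PA; apply/chi_coneP; exists (fun S => g S / \sum_S b S); split=> [S|S /negbTE SP|i].
  - by rewrite divr_ge0 // ltW.
  - by rewrite /g SP mul0r.
  - under eq_bigr do rewrite mulrAC.
    by rewrite -mulr_suml gE mulrAC divff // mul1r.
have := cS0; suff -> : c S0 = 0 by rewrite ltxx.
have [SP|SP] := boolP (S0 \in P); last first.
  move/eqP: t0; rewrite psumr_eq0 // => /allP/(_ S0 (mem_index_enum _)).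
  by rewrite /b (negbTE SP) => /eqP.
have /set0Pn[i iS] : S0 != set0 by apply: contraNneq P0 => <-.
have /eqP := gE i; rewrite t0 mul0r psumr_eq0 => [/allP/(_ S0 (mem_index_enum _))|S _].
  by rewrite /g SP iS mulr1 => /eqP.
by rewrite mulr_ge0.
Qed.

(* The second clause of reducibility is automatic: trading the members of B
   below A for A itself, some coefficient of lambda is the first to vanish. *)
Lemma irreducible_not_cone B A : min_balanced R B -> ~ reducible R B ->
  A != set0 -> A \proper cover B -> ~ chi_cone (strict_below B A) (chi R A).
Proof.
move=> B_mb Birr A0 AM HA; apply: Birr; move: (HA) => /chi_coneP[d [d0 dB dA]].
have [l0 lpos lB lM] := lambdaP B_mb.
have [S0 dS0|d_le0] := pickP (fun S => 0 < d S); last first.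
  case/set0Pn: A0 => i iA; have := dA i; rewrite iA big1 => [/eqP|S _].
    by rewrite eq_sym oner_eq0.
  have := d_le0 S; rewrite lt0r d0 andbT => /negbFE/eqP->; exact: mul0r.
have [S1 dS1 ge0] := ratio_test l0 dS0; set t := _ / _ in ge0.
have S1B : S1 \in strict_below B A by apply: contraTT dS1 => /dB->; rewrite ltxx.
exists A, S1; split=> //; apply/chi_coneP.
exists (fun S => lambda R B S + (- t) * d S + t * (S == A)%:R); split=> [S|S|i].
- by rewrite mulNr addr_ge0 // mulr_ge0 ?ler0n // divr_ge0.
- rewrite !inE negb_or negb_and negbK => /andP[/negbTE-> /orP[/eqP->|SB]].
    by rewrite mulNr divfK ?subrr ?mulr0 ?addr0 // gt_eqF.
  rewrite lB // dB ?mulr0 ?addr0 //; by rewrite inE (negbTE SB).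
- under eq_bigr do rewrite mulrDl -(mulrA t).
  by rewrite big_split -mulr_sumr sum_delta (balances_affine (- t) lM dA) /=; ring.
Qed.

(** * Facets *)

Lemma mem_direction (X : set game) (W : {vspace game}) m v (e : R) :
  (forall m1 m2, X m1 -> X m2 -> m1 - m2 \in W) -> X m -> X (m + e *: v) -> 0 < e -> v \in W.
Proof.
move=> XW mX vX e0; have := XW _ _ vX mX; rewrite addrAC subrr add0r.
by rewrite rpredZeq gt_eqF.
Qed.

Lemma tb_cone_full (W : {vspace game}) :
  (forall m1 m2, tb_cone m1 -> tb_cone m2 -> m1 - m2 \in W) -> W = fullv.
Proof.
move=> KW; apply/vspaceP => v; rewrite memvf.
have [e e0 eK] := slack_small_tb_cone v square_slack.
exact: mem_direction KW (slack_tb_cone square_slack) eK e0.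
Qed.

(** The tight set of the zero functional is the whole cone, which would have dimensions [d] and
    [d.+1]. *)
Lemma facet_defining_neq0 a : facet_defining (@tb_cone R N) a -> a != 0.
Proof.
move=> [_ [_ [d [[_ [U [FU Umin Ud]]] [_ [W [KW Wmin Wd]]]]]]].
apply/eqP => a0; have : (W <= U)%VS.
  apply: Wmin => m1 m2 K1 K2; apply: FU; split=> //; rewrite a0.
    by rewrite scalar_prodC linear0.
  by rewrite scalar_prodC linear0.
by move=> /dimvS; rewrite Ud Wd ltnn.
Qed.

(** By dimension, the differences of facet points span the whole hyperplane of [a], so [g] vanishes
    there. Then [g] minus its orthogonal projection onto [a] is orthogonal to itself. *)
Lemma facet_functional_unique a g : facet_defining (@tb_cone R N) a ->
  (forall m, tight_set (@tb_cone R N) a m -> scalar_prod g m = 0) ->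
  exists t : R, g = t *: a.
Proof.
move=> aF gF; have a0 := facet_defining_neq0 aF.
move: aF => [_ [_ [d [[_ [U [FU Umin Ud]]] [_ [W [KW Wmin Wd]]]]]]].
have Ua : U = hyperplane a.
  apply/eqP; rewrite eqEdim; apply/andP; split.
    apply: Umin => m1 m2 [_ m1a] [_ m2a]; rewrite mem_hyperplane linearB /= m1a m2a.
    by rewrite subrr.
  by rewrite -ltnS dim_hyperplane // Ud -Wd (tb_cone_full KW).
have Ug : (U <= hyperplane g)%VS.
  apply: Umin => m1 m2 F1 F2; rewrite mem_hyperplane linearB /= !gF //.
  by rewrite subrr.
have aa := scalar_prod_self_gt0 a0.
pose t := scalar_prod a g / scalar_prod a a; exists t.
pose v := g + (- t) *: a.
have av : scalar_prod a v = 0 by rewrite scalar_prod_affine mulNr divfK ?subrr // gt_eqF.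
have gv : scalar_prod g v = 0.
  by apply/eqP; rewrite -mem_hyperplane (subvP Ug) // Ua mem_hyperplane av.
apply/eqP; rewrite -subr_eq0 -scaleNr -/v; apply: contraT => /scalar_prod_self_gt0.
by rewrite {2}/v scalar_prod_affine ![scalar_prod v _]scalar_prodC gv av mulr0 addr0 ltxx.
Qed.

(* m0 vanishes on B and on its carrier, is tiny and negative on the other
   subsets of the carrier (tinier on larger sets), and is strictly convex
   elsewhere.  All its restrictions have a core with interior, except on the
   carrier, where 0 is a core element that is tight exactly on B. *)
Lemma irreducible_tight_point B : nontrivial B -> min_balanced R B -> ~ reducible R B ->
  exists m0, forall v, scalar_prod (alpha_of R B) v = 0 ->
    exists2 e : R, 0 < e & tight_set (@tb_cone R N) (alpha_of R B) (m0 + e *: v).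
Proof.
move=> Bnt B_mb Birr; set M := cover B.
have [l0 lpos lB lM] := lambdaP B_mb.
have M0 := min_balanced_cover_neq0 B_mb; have B0 := set0_notin_min_balanced B_mb.
have BM S : S \in B -> S \subset M by move=> SB; apply: (bigcup_sup S).
have /choice[y yP] A : exists y, A != set0 -> A \proper M ->
    mass y A = -1 /\ forall S, S \in strict_below B A -> 0 < mass y S.
  have [A0|A0] := boolP (A != set0); last by exists (fun=> 0).
  have [AM|AM] := boolP (A \proper M); last by exists (fun=> 0).
  have [|y ?] := separating_vector A0 _ (irreducible_not_cone B_mb Birr A0 AM).
    by rewrite inE (negbTE B0).
  by exists y.
have [|e0 e0_gt0 e0P] := @small_forall R ({set N} * {set N})%type
    (fun p e => 0 < 1 + e * mass (y p.1) p.2).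
  by move=> p; apply: small_affine_gt0; exact: ltr01.
pose h := Num.min e0 1; have h0 : 0 < h by rewrite lt_min e0_gt0 ltr01.
have h1 : h <= 1 by rewrite ge_min lexx orbT.
have hP A S : 0 < 1 + h * mass (y A) S.
  by apply: (e0P h _ (A, S)); rewrite h0 ge_min lexx.
pose m0 : game := [ffun S : {set N} => if S == set0 then 0 else if S \subset M then
  (if (S \in B) || (S == M) then 0 else - h ^+ #|S|) else #|S|%:R ^+ 2].
have tE S : tilde m0 S = m0 S by rewrite ffunE [m0 set0]ffunE eqxx subr0.
have m0B S : S \in B -> m0 S = 0 by move=> SB; rewrite ffunE SB BM //; case: ifP.
have m0M : m0 M = 0 by rewrite ffunE (negbTE M0) subxx eqxx orbT.
have m0_le S : m0 S <= #|S|%:R ^+ 2.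
  have c0 : 0 <= #|S|%:R ^+ 2 :> R by rewrite exprn_ge0 ?ler0n.
  rewrite ffunE; case: ifP => // _; case: ifP => // _; case: ifP => // _.
  by rewrite (le_trans _ c0) // oppr_le0 exprn_ge0 // ltW.
have m0S A : A != set0 -> A != M -> slack m0 A.
  move=> A0 AM; have cA : #|A|%:R != 0 :> R by rewrite pnatr_eq0 cards_eq0.
  have [sAM|sAM] := boolP (A \subset M); last first.
    exists (fun=> #|A|%:R); split=> [|S S0 SA]; rewrite mass_cst tE.
      by rewrite ffunE (negbTE A0) (negbTE sAM) expr2.
    rewrite (le_lt_trans (m0_le S)) // expr2 ltr_pM2r ?ltr_nat ?proper_card //.
    by rewrite ltr0n card_gt0.
  have pAM : A \proper M by rewrite properEneq AM.
  have [yA yS] := yP A A0 pAM.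
  pose u : R := (A \in B)%:R / #|A|%:R.
  have u0 : 0 <= u by rewrite divr_ge0 ?ler0n.
  (* The vector [y A] has mass -1 on [A]; when [A] is in [B], where [m0] is 0 instead of
     [- h ^+ #|A|], the uniform term [u] compensates. *)
  exists (fun i => h ^+ #|A| * (u + 1 * y A i)); split=> [|S S0 SA];
    rewrite mass_scale mass_affine mass_cst mul1r tE.
    rewrite yA divfK // ffunE (negbTE A0) sAM (negbTE AM) orbF.
    by case: (A \in B); rewrite ?subrr ?mulr0 // sub0r mulrN1.
  have hA : 0 < h ^+ #|A| by rewrite exprn_gt0.
  apply: (@lt_le_trans _ _ (h ^+ #|A| * mass (y A) S)); last first.
    by rewrite ler_pM2l // lerDr mulr_ge0 ?ler0n.
  have sSM : S \subset M := subset_trans (proper_sub SA) sAM.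
  have SM : S != M by apply: contraTneq SA => ->; rewrite properE sAM andbF.
  rewrite ffunE (negbTE S0) sSM (negbTE SM) orbF.
  case: ifP => SB; first by rewrite mulr_gt0 // yS // inE SB.
  have [w0|w0] := leP 0 (mass (y A) S).
    by rewrite (@lt_le_trans _ _ 0) ?oppr_lt0 ?exprn_gt0 // mulr_ge0 // ltW.
  (* The mass is negative and [#|S| < #|A|], so lowering the exponent to [#|S|.+1] only decreases
     the value; the choice of [h] then suffices. *)
  apply: (@lt_le_trans _ _ (h ^+ #|S|.+1 * mass (y A) S)); last first.
    by rewrite ler_nM2r // ler_wiXn2l ?(ltW h0) ?proper_card.
  rewrite exprSr -mulrA -subr_gt0 opprK -[X in _ + X]mulr1 -mulrDr addrC.
  by rewrite mulr_gt0 ?exprn_gt0 // addrC hP.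
exists m0 => v av.
(* Matching [tilde v] on [B] forces a match on [M], by orthogonality to [alpha_of R B]; so [e * y']
   stays in the core at [M], tight on [B]. *)
have [y' y'B] := min_balanced_interpolation B_mb (tilde v).
have y'M : mass y' M = tilde v M.
  rewrite -(balances_mass y' lM); move/eqP: av.
  rewrite alpha_ofE // scalar_prodZl mulf_eq0 pnatr_eq0 gtn_eqF ?least_multiplier_gt0 //=.
  rewrite scalar_prod_bal subr_eq0 => /eqP->; apply: eq_bigr => S _.
  by have [SB|/lB->] := boolP (S \in B); [rewrite y'B | rewrite !mul0r].
have [|e e_gt0 eP] := @small_forall R {set N} (fun A e => A != set0 ->
    if A == M then forall S, S \subset M -> tilde (m0 + e *: v) S <= e * mass y' S
    else slack (m0 + e *: v) A).
  move=> A; have [->|A0] := eqVneq A set0; first by exists 1.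
  have [_|AM] := eqVneq A M; last first.
    by have [e ? eP] := slack_small v (m0S A A0 AM) A0; exists e => // f /eP.
  have [|e e_gt0 eP] := @small_forall R {set N} (fun S e => S \subset M ->
      tilde (m0 + e *: v) S <= e * mass y' S).
    move=> S; have [->|S0] := eqVneq S set0; first by exists 1 => // e _ _; rewrite tilde0 mass0 mulr0.
    have [sSM|_] := boolP (S \subset M); last by exists 1.
    have [->|SM] := eqVneq S M.
      by exists 1 => // e _ _; rewrite tilde_affine tE m0M y'M add0r.
    have [SB|SB] := boolP (S \in B).
      by exists 1 => // e _ _; rewrite tilde_affine tE m0B ?y'B // add0r.
    have [|e e_gt0 eP] := @small_affine_gt0 R (h ^+ #|S|) (mass y' S - tilde v S).
      exact: exprn_gt0.
    exists e => // f /eP; rewrite tilde_affine tE [m0 S]ffunE (negbTE S0) sSM (negbTE SB) (negbTE SM) /=.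
    by move=> + _; lra.
  by exists e => // f /eP.
have {}eP := eP e; rewrite e_gt0 lexx in eP; have {}eP := eP isT.
exists e => //; split.
  apply/tb_coneP => A A0; have := eP A A0; have [->|_] := eqVneq A M => [H|]; last exact: slack_feasible.
  by exists (fun i => e * y' i); split=> [|S /H]; rewrite mass_scale // tilde_affine tE m0M y'M add0r.
rewrite scalar_prod_affine av mulr0 addr0 alpha_ofE // scalar_prodZl scalar_prod_bal -/M.
rewrite tE m0M big1 ?subrr ?mulr0 // => S _.
by have [/m0B m0S0|/lB->] := boolP (S \in B); rewrite ?mul0r // tE m0S0 mulr0.
Qed.

(** From [m0] every direction of the hyperplane can be followed a little within the tight set, which
    therefore has codimension one. *)
Lemma irreducible_facet B : nontrivial B -> min_balanced R B -> ~ reducible R B ->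
  facet_defining (@tb_cone R N) (alpha_of R B).
Proof.
move=> Bnt B_mb Birr; set a := alpha_of R B.
have aV := valid_alpha_of B_mb Bnt; have a0 := alpha_of_neq0 B_mb Bnt.
have [m0 m0P] := irreducible_tight_point Bnt B_mb Birr.
have m0F : tight_set (@tb_cone R N) a m0.
  by have [|e _] := m0P 0; [exact: linear0 | rewrite scaler0 addr0].
split=> //; split; first by exists a.
exists (\dim (hyperplane a)); split.
  split; first by exists m0.
  exists (hyperplane a); split=> // [m1 m2 [_ m1a] [_ m2a]|W FW].
    by rewrite mem_hyperplane linearB /= m1a m2a subrr.
  apply/subvP => v; rewrite mem_hyperplane => /eqP/m0P[e e_gt0 eF].
  exact: mem_direction FW m0F eF e_gt0.
split; first by exists m0; case: m0F.
exists fullv; split=> [m1 m2 _ _|W KW|]; first exact: memvf.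
  by rewrite (tb_cone_full KW).
by rewrite dim_hyperplane.
Qed.

Lemma facet_defining_scale a (e : R) : 0 < e ->
  facet_defining (@tb_cone R N) a -> facet_defining (@tb_cone R N) (e *: a).
Proof.
move=> e0 [aV [_ aF]].
have eV : valid_ineq (@tb_cone R N) (e *: a).
  by move=> m mK; rewrite scalar_prodZl mulr_ge0 ?aV // ltW.
split=> //; split; first by exists (e *: a).
suff -> : tight_set (@tb_cone R N) (e *: a) = tight_set (@tb_cone R N) a by [].
apply/seteqP; split=> m [mK ma]; split=> //; last by rewrite scalar_prodZl ma mulr0.
by move/eqP: ma; rewrite scalar_prodZl mulf_eq0 gt_eqF //= => /eqP.
Qed.

(* The points of the facet witnessing that no single alpha_of B vanishes on it
   would add up to a point of the facet lying in the interior of the cone. *)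
Lemma facet_min_balanced a : facet_defining (@tb_cone R N) a ->
  exists B, [/\ nontrivial B, min_balanced R B &
    forall m, tight_set (@tb_cone R N) a m -> scalar_prod (alpha_of R B) m = 0].
Proof.
move=> aF; apply: contrapT => noB; have a0 := facet_defining_neq0 aF.
have /choice[p pP] B : exists m, tight_set (@tb_cone R N) a m /\
    (nontrivial B -> min_balanced R B -> scalar_prod (alpha_of R B) m != 0).
  apply: contrapT => H; apply: noB; exists B.
  have F0 : tight_set (@tb_cone R N) a 0 by split; [exact: tb_cone0 | rewrite linear0].
  have [Bnt|Bnt] := pselect (nontrivial B); last by case: H; exists 0.
  have [B_mb|B_mb] := pselect (min_balanced R B); last by case: H; exists 0.
  split=> // m mF; apply/eqP; apply: contraT => Bm; case: H; exists m; split=> //.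
pose q := \sum_B p B.
have qK : tb_cone q.
  apply: (big_ind (fun m => tb_cone m)); first exact: tb_cone0.
    exact: tb_coneD.
  by move=> B _; have [[]] := pP B.
have qa : scalar_prod a q = 0.
  by rewrite linear_sum big1 // => B _; have [[]] := pP B.
have [A A0 qA] : exists2 A, A != set0 & ~ slack q A.
  apply: contrapT => H; have [aV _] := aF.
  have := @valid_slack_gt0 a q aV a0; rewrite qa ltxx => H'; suff : false by [].
  apply: H' => A A0; apply: contrapT => qA; apply: H; by exists A.
have [c [c0 cgood cA cq]] := not_slack_tight qK A0 qA.
have [B [Bnt B_mb Bq]] := tight_min_balanced qK A0 c0 cgood cA cq.
(* The value at [q] is a sum of nonnegative terms, so it vanishes at [p B] too, against the choice
   of [p B]. *)
have [_ /(_ Bnt B_mb)/eqP] := pP B; apply; move/eqP: Bq.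
have BV := valid_alpha_of B_mb Bnt.
rewrite linear_sum psumr_eq0 => [/allP/(_ B (mem_index_enum _))/eqP//|B' _].
by apply: BV; have [[]] := pP B'.
Qed.

(** Substituting [d] for [A] in [c] recovers [lambda], so the inequality of [B] is that of [c] plus
    [c A] times that of [d]. The latter vanishes on the facet, hence is a multiple of
    [alpha_of R B]; the entry at the carrier makes the multiple zero, while the entry at [A] is
    1. *)
Lemma facet_irreducible B : nontrivial B -> min_balanced R B ->
  facet_defining (@tb_cone R N) (alpha_of R B) -> ~ reducible R B.
Proof.
move=> Bnt B_mb BF [A [S [AM SA /chi_coneP[d [d0 dB dA]] /chi_coneP[c [c0 cB cM]]]]].
have MB := cover_notin_min_balanced B_mb Bnt; have M0 := min_balanced_cover_neq0 B_mb.
move: SA; rewrite inE => /andP[SB SA].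
have A0 : A != set0 by apply: contraTneq SA => ->; rewrite properE sub0set andbF.
have dAA : d A = 0 by apply: dB; rewrite inE properxx andbF.
pose f T := c T + c A * (d T - (T == A)%:R).
have fl : forall T, f T = lambda R B T.
  apply: lambda_unique => // [T TB|i].
    rewrite /f (dB T) ?inE ?(negbTE TB) // sub0r; have [->|TA] := eqVneq T A.
      by rewrite mulrN1 subrr.
    by rewrite cB ?oppr0 ?mulr0 ?addr0 // !inE negb_or TA negb_and TB orbT.
  under eq_bigr do rewrite mulrDl -mulrA mulrBl.
  by rewrite big_split -mulr_sumr sumrB cM dA sum_delta /= subrr mulr0 addr0.
have cA_gt0 : 0 < c A.
  rewrite lt0r c0 andbT; apply/eqP => cA.
  have [_ _ Bmin] := B_mb; apply: (Bmin (B :\ S)); first exact: properD1.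
  apply/chi_coneP; exists c; split=> // T TB; have [->//|TA] := eqVneq T A.
  by apply: cB; rewrite in_setU1 negb_or TA.
have split_bal m : scalar_prod (bal_ineq (cover B) (lambda R B)) m =
    scalar_prod (bal_ineq (cover B) c) m + c A * scalar_prod (bal_ineq A d) m.
  rewrite !scalar_prod_bal; under eq_bigr do rewrite -fl /f mulrDl -mulrA mulrBl.
  by rewrite big_split -mulr_sumr sumrB sum_delta /=; ring.
have [|t tE] := @facet_functional_unique _ (bal_ineq A d) BF.
  move=> m [mK]; rewrite alpha_ofE // scalar_prodZl => /eqP.
  rewrite mulf_eq0 pnatr_eq0 gtn_eqF ?least_multiplier_gt0 //= split_bal.
  have dm := valid_bal d0 dA A0 mK.
  rewrite paddr_eq0 ?(valid_bal c0 cM) // ?mulr_ge0 // => /andP[_].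
  by rewrite mulf_eq0 gt_eqF //= => /eqP.
have t0 : t = 0.
  move/ffunP/(_ (cover B))/eqP: (tE); rewrite !ffunE /GRing.scale /= eqxx.
  have /negbTE-> : cover B != A by apply: contraTneq AM => ->; rewrite properxx.
  rewrite (dB (cover B)) ?inE ?(negbTE MB) // (negbTE M0) subrr mul0r addr0 eq_sym mulf_eq0.
  by rewrite pnatr_eq0 gtn_eqF ?least_multiplier_gt0 // orbF => /eqP.
move/ffunP/(_ A)/eqP: tE; rewrite t0 scale0r !ffunE eqxx (negbTE A0) dAA.
by rewrite subr0 mul0r addr0 oner_eq0.
Qed.

End Cone.

Theorem theorem1 (R : realType) (N : finType) (hN : (2 <= #|N|)%N)
    (alpha : {ffun {set N} -> R^o}) :
  facet_defining (@tb_cone R N) alpha <->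
  exists B : {set {set N}},
    [/\ nontrivial B,
        min_balanced R B,
        ~ reducible R B &
        exists2 c : R, 0 < c & alpha = c *: alpha_of R B].
Proof.
split=> [aF|[B [Bnt B_mb Birr [c c0 ->]]]]; last first.
  exact: facet_defining_scale c0 (irreducible_facet Bnt B_mb Birr).
have [B [Bnt B_mb BF]] := facet_min_balanced aF.
have [t tE] := facet_functional_unique aF BF.
(* Both functionals are positive at the interior point [square_game]. *)
have t0 : 0 < t.
  have := valid_slack_gt0 (valid_alpha_of B_mb Bnt) (alpha_of_neq0 B_mb Bnt) (@square_slack R N).
  rewrite tE scalar_prodZl pmulr_lgt0 //.
  by apply: valid_slack_gt0 (@square_slack R N); [case: aF | exact: facet_defining_neq0].
exists B; split=> //.
  by apply: facet_irreducible => //; rewrite tE; apply: facet_defining_scale.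
by exists t^-1; [rewrite invr_gt0 | rewrite tE scalerA mulVf ?scale1r // gt_eqF].
Qed.
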